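(* Let $\Gamma$ be a canonical signed unicyclic graph whose unique cycle $C_g^\sigma$ has length $g$. (1) If $\Gamma=C_g^\sigma$ is a cycle, then $i_+(\Gamma)=\lceil g/2\rceil$ if and only if either $C_g^\sigma$ is balanced and $g\equiv 1,2\pmod 4$, or $C_g^\sigma$ is unbalanced and $g\equiv 0,3\pmod 4$. Suppose now $\Gamma$ is not a cycle. Let $v_1,\dots,v_k$ ($k\ge1$) be the major vertices in cyclic order along $C_g^\sigma$, and let $l_1,\dots,l_k\ge0$ be the numbers of cycle vertices strictly between consecutive major vertices (indices mod $k$; for $k=1$, $l_1=g-1$), so that $g=k+l_1+\cdots+l_k$. (2) If $g\equiv 1,3\pmod 4$, then $i_+(\Gamma)=\lceil g/2\rceil$ if and only if exactly one of $l_1,\dots,l_k$ is even. (3) If $g\equiv 0,2\pmod 4$, then $i_+(\Gamma)=\lceil g/2\rceil$ if and only if all of $l_1,\dots,l_k$ are odd.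
   Context: A signed graph $\Gamma=(G,\sigma)$ is a simple graph $G$ with a sign function $\sigma:E(G)\to\{+,-\}$; its adjacency matrix has $(u,v)$-entry $\sigma(uv)$ if $uv\in E(G)$, $0$ otherwise, and $i_+(\Gamma)$ is its number of positive eigenvalues. A cycle is balanced if the product of its edge signs is $+$, unbalanced otherwise. A signed unicyclic graph is a connected signed graph with exactly one cycle. It is called canonical if, with $C$ its unique cycle, every vertex not on $C$ is adjacent to exactly one vertex of $C$ and the vertices not on $C$ are pairwise nonadjacent. A vertex of $C$ having at least one neighbour outside $C$ is called a major vertex. *)

(* Defs.v *)
From HB Require Import structures.
From mathcomp Require Import all_boot all_order all_algebra.
From mathcomp.real_closed Require Import polyrcf.
Set Implicit Arguments. Unset Strict Implicit. Unset Printing Implicit Defensive.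
Import Order.TTheory GRing.Theory Num.Theory.
Local Open Scope ring_scope.

(* A signed graph on vertex set 'I_n: adjacency relation [adj] (assumed
   symmetric and irreflexive) and sign relation [pos] (pos x y = true means
   the edge xy has sign +, false means sign -; assumed symmetric). *)

Definition signed_adj (R : pzRingType) (n : nat) (adj pos : rel 'I_n) : 'M[R]_n :=
  \matrix_(i, j) (if adj i j then (if pos i j then 1 else -1) else 0).

Definition i_plus (R : rcfType) (n : nat) (A : 'M[R]_n) : nat :=
  (\sum_(x <- rootsR (char_poly A) | (0 < x)%R) mup x (char_poly A))%N.

Definition is_cycle (n : nat) (adj : rel 'I_n) (c : seq 'I_n) : bool :=
  [&& uniq c, (2 < size c)%N & cycle adj c].

Definition cycle_edges (n : nat) (c : seq 'I_n) : {set 'I_n * 'I_n} :=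
  [set p : 'I_n * 'I_n | [&& p.1 \in c, p.2 \in c &
                           (next c p.1 == p.2) || (next c p.2 == p.1)]].

Definition connected_graph (n : nat) (adj : rel 'I_n) : Prop :=
  forall x y : 'I_n, connect adj x y.

(* connected with exactly one cycle (cycles identified as subgraphs) *)
Definition unicyclic (n : nat) (adj : rel 'I_n) : Prop :=
  connected_graph adj /\ (exists c, is_cycle adj c) /\
  (forall c1 c2, is_cycle adj c1 -> is_cycle adj c2 ->
     cycle_edges c1 = cycle_edges c2).

Definition canonical (n : nat) (adj : rel 'I_n) (c : seq 'I_n) : Prop :=
  (forall x, x \notin c -> #|[set y in c | adj x y]| = 1%N) /\
  (forall x y, x \notin c -> y \notin c -> ~~ adj x y).

Definition balanced (n : nat) (pos : rel 'I_n) (c : seq 'I_n) : bool :=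
  (\prod_(x <- c) (if pos x (next c x) then 1 else -1 : int)) == 1.

Definition major (n : nat) (adj : rel 'I_n) (c : seq 'I_n) (x : 'I_n) : bool :=
  (x \in c) && [exists y, (y \notin c) && adj x y].

(* for the major vertex at position i of c: number of cycle vertices strictly
   between it and the next major vertex along c (cyclically) *)
Definition gap (n : nat) (adj : rel 'I_n) (c : seq 'I_n) (i : nat) : nat :=
  find (major adj c) (rot i.+1 c).

Definition gaps (n : nat) (adj : rel 'I_n) (c : seq 'I_n) : seq nat :=
  [seq gap adj c p.1 | p <- zip (iota 0 (size c)) c & major adj c p.2].

(* Main.v *)
(* The number of positive eigenvalues of a symmetric matrix is read off its
   quadratic form q: m linear constraints forcing q <= 0 give i_+ <= m, and m
   constraints forcing q > 0 off the origin give n <= i_+ + m.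

   If the graph is not a cycle, let S consist of the cycle vertices at even
   distance from the next major vertex.  S is a vertex cover, and mapping a major
   vertex to one of its leaves, and any other vertex of S to its successor on the
   cycle, gives a triangular matching of S into its complement; hence i_+ = |S|.
   Counting S gives 2 i_+ = g + #{even gaps}, and (2), (3) follow by parity.

   For the cycle, q/2 = \sum_(i < g) s_i x_i x_(i+1).  With h = g/2 rounded down, group
   2h consecutive terms as x_(2j+1) y_j, where y_j is a signed sum of x_(2j) and
   x_(2j+2).  A telescoping identity expresses x_(2h) by x_0 and the y_j, which
   diagonalises q up to the sign (-1)^h s_0 ... s_(g-1). *)

Require Import Defs.
From HB Require Import structures.
From mathcomp Require Import all_boot all_order all_algebra.
From mathcomp.real_closed Require Import polyrcf complex.
From mathcomp Require Import ring zify.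
Set Implicit Arguments. Unset Strict Implicit. Unset Printing Implicit Defensive.
Import Order.TTheory GRing.Theory Num.Theory.
Local Open Scope ring_scope.

(** * Linear algebra preliminaries *)

Lemma common_kernel_neq0 (K : fieldType) (n : nat) (I : finType)
    (F : I -> 'cV[K]_n) :
  (#|I| < n)%N -> exists2 w : 'rV[K]_n, w != 0 & forall i, w *m F i = 0.
Proof.
move=> ltIn; pose M : 'M[K]_(n, #|I|) := \matrix_(j, k) F (enum_val k) j 0.
have kerM0 : kermx M != 0.
  rewrite -mxrank_eq0 mxrank_ker subn_eq0 -ltnNge.
  exact: leq_ltn_trans (rank_leq_col M) ltIn.
exists (nz_row (kermx M)); first by rewrite nz_row_eq0.
move=> i; have /sub_kermxP/matrixP w0 := nz_row_sub (kermx M).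
apply/matrixP=> a b; rewrite !ord1 -[LHS]/((_ *m _) 0 0) mxE [RHS]mxE.
move: (w0 0 (enum_rank i)); rewrite !mxE => w0i.
by rewrite -[RHS]w0i; apply: eq_bigr => j _; rewrite mxE enum_rankK.
Qed.

Definition qform (R : nzRingType) n (A : 'M[R]_n) (v : 'rV[R]_n) : R :=
  (v *m A *m v^T) 0 0.

Lemma qformE (R : nzRingType) n (A : 'M[R]_n) (v : 'rV[R]_n) :
  qform A v = \sum_j (\sum_i v 0 i * A i j) * v 0 j.
Proof. by rewrite /qform mxE; apply: eq_bigr => j _; rewrite !mxE. Qed.

Lemma char_poly_similar (K : fieldType) n (A D P : 'M[K]_n) :
  P \in unitmx -> P *m A = D *m P -> char_poly A = char_poly D.
Proof.
move=> Punit PAD; have detP0: \det (map_mx polyC P) != 0.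
  by rewrite det_map_mx polyC_eq0 -unitfE -unitmxE.
apply: (mulfI detP0); rewrite [RHS]mulrC -!det_mulmx; congr (\det _).
rewrite /char_poly_mx mulmxBr mulmxBl -!map_mxM PAD; congr (_ - _).
by rewrite mul_scalar_mx mul_mx_scalar.
Qed.

(** * Positive eigenvalues counted through the quadratic form *)

Section Inertia.
Variables (R : rcfType) (n : nat) (A : 'M[R]_n).
Hypothesis symA : A^T = A.

Local Open Scope sesquilinear_scope.

Local Notation toC := (real_complex R).
Local Notation AC := (map_mx toC A).
Local Notation U := (spectralmx AC).

(** Diagonalisation takes place over [R[i]]; since [A] is symmetric the diagonal is real, so taking
    real parts loses nothing. *)
Definition real_eigenvalue (j : 'I_n) : R := complex.Re (spectral_diag AC 0 j).

Lemma map_symmetric_hermitian : AC \is hermsymmx.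
Proof.
apply: realsym_hermsym; last by apply/mxOverP => a b; rewrite mxE complex_real.
by apply/is_hermitianmxP; rewrite expr0 scale1r map_mx_id // map_trmx symA.
Qed.

Lemma real_eigenvalueE : map_mx toC (\row_j real_eigenvalue j) = spectral_diag AC.
Proof.
apply/rowP=> j; rewrite !mxE; apply: RRe_real.
by move/hermitian_spectral_diag_real/mxOverP: map_symmetric_hermitian; apply.
Qed.

Lemma spectral_decomposition : AC = invmx U *m diag_mx (spectral_diag AC) *m U.
Proof. exact/orthomx_spectralP/hermitian_normalmx/map_symmetric_hermitian. Qed.

Lemma char_poly_real_eigenvalue : char_poly A = \prod_j ('X - (real_eigenvalue j)%:P).
Proof.
apply: (map_poly_inj toC); rewrite map_char_poly rmorph_prod.
rewrite (char_poly_similar (spectral_unit AC) (D := diag_mx (spectral_diag AC))).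
  rewrite char_poly_trig ?diag_mx_is_trig //; apply: eq_bigr => j _.
  by rewrite /= map_polyXsubC -real_eigenvalueE !mxE eqxx.
by rewrite [X in _ *m X = _]spectral_decomposition !mulmxA mulmxV ?spectral_unit // mul1mx.
Qed.

Lemma i_plusE : i_plus A = #|[pred j | 0 < real_eigenvalue j]|.
Proof.
have pE : char_poly A = \prod_(y <- codom real_eigenvalue) ('X - y%:P).
  by rewrite char_poly_real_eigenvalue big_map enumT.
have p0 : char_poly A != 0 by rewrite monic_neq0 ?char_poly_monic.
rewrite /i_plus -big_filter; under eq_bigr do rewrite pE mu_prod_XsubC.
rewrite -sum1_card.
transitivity (\sum_(x <- [seq x <- rootsR (char_poly A) | (0 < x)%R])
    \sum_j (real_eigenvalue j == x))%N.
  by apply: eq_bigr => x _; rewrite -sum1_count big_map enumT big_mkcond.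
(* After exchanging the sums, an index [j] contributes 1 exactly when its eigenvalue occurs among
   the positive roots, which are listed without repetition. *)
rewrite exchange_big [RHS]big_mkcond; apply: eq_bigr => j _ /=.
have rj : real_eigenvalue j \in rootsR (char_poly A).
  have := roots_on_rootsR p0 (real_eigenvalue j); rewrite in_itv /= => <-.
  by rewrite pE root_prod_XsubC codom_f.
rewrite inE; case: ifPn => ej.
  rewrite (bigD1_seq (real_eigenvalue j)) ?filter_uniq ?uniq_roots ?mem_filter ?ej //= eqxx.
  by rewrite big1_seq // => x /andP[]; rewrite eq_sym => /negPf->.
rewrite big1_seq // => x /=; rewrite mem_filter => /andP[x0 _].
by case: eqP x0 ej => // <- ->.
Qed.

(** For [w = x + iy] the cross terms of the Hermitian form cancel by symmetry of [A], leaving q(x) +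
    q(y); in the unitary eigenbasis the same form is diagonal. This transfers sign information
    between real vectors and the complex spectral decomposition. *)
Lemma qform_complex (w : 'rV[R[i]]_n) :
  toC (qform A (map_mx (@complex.Re R) w) + qform A (map_mx (@complex.Im R) w))
  = \sum_j toC (real_eigenvalue j) * `|(w *m U^t*) 0 j| ^+ 2.
Proof.
transitivity ((w *m AC *m w^t*) 0 0).
  set x := map_mx _ w; set y := map_mx _ w.
  have wE : w = map_mx toC x + 'i%C *: map_mx toC y.
    by apply/rowP=> j; rewrite !mxE -complexE.
  have wsE : w^t* = map_mx toC x^T - 'i%C *: map_mx toC y^T.
    apply/colP=> j; rewrite !mxE /=.
    by rewrite [in LHS](complexE (w 0 j)); case: (w 0 j) => a b /=; simpc.
  rewrite wsE {1}wE mulmxDl mulmxBr !mulmxDl -!scalemxAl -!scalemxAr scalerA -!map_mxM.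
  have -> : (y *m A *m x^T) = (x *m A *m y^T).
    by rewrite [RHS]mx11_scalar -tr_scalar_mx -mx11_scalar !trmx_mul trmxK symA mulmxA.
  rewrite /qform; move: (x *m A *m x^T) (x *m A *m y^T) (y *m A *m y^T) => a b d.
  rewrite !mxE rmorphD /=.
  by rewrite -expr2 sqr_i; ring.
rewrite [X in w *m X]spectral_decomposition invmx_unitary ?spectral_unitarymx //.
rewrite !mulmxA -(mulmxA _ U).
have -> : U *m w^t* = (w *m U^t*)^t* by rewrite trmx_mul map_mxM /= trmxCK.
move: (w *m U^t*) => z; rewrite mxE; apply: eq_bigr => j _.
rewrite mul_mx_diag mxE -real_eigenvalueE !mxE mulrAC mulrC; congr (_ * _).
by rewrite normCK.
Qed.


Lemma scalar_delta (f : 'rV[R]_n -> R) : scalar f ->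
  forall v, f v = (v *m (\col_j f (delta_mx 0 j) : 'cV_n)) 0 0.
Proof.
move=> lin v; pose g : {scalar 'rV[R]_n} :=
  HB.pack f (GRing.isLinear.Build _ _ _ _ f lin).
rewrite -[f v]/(g v) {1}(row_sum_delta v) linear_sum mxE.
by apply: eq_bigr => j _; rewrite linearZ mxE.
Qed.

Lemma spectral_constraints_neq0 (I : finType) (f : I -> 'rV[R]_n -> R)
    (J : pred 'I_n) :
  (forall i, scalar (f i)) -> (#|I| + #|J| < n)%N ->
  exists w : 'rV[R[i]]_n,
    [/\ w *m U^t* != 0, forall j, J j -> (w *m U^t*) 0 j = 0 &
        forall i, f i (map_mx (@complex.Re R) w) = 0
               /\ f i (map_mx (@complex.Im R) w) = 0].
Proof.
move=> lin ltIJn.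
(* A real linear form is imposed on [w] as a single complex constraint: its coefficients being real,
   it then vanishes on the real and imaginary parts separately. *)
pose F (k : I + {j | J j}) : 'cV[R[i]]_n :=
  match k with
  | inl i => map_mx toC (\col_j f i (delta_mx 0 j))
  | inr j => col (val j) (U^t*)
  end.
have [|w w0 Fw] := @common_kernel_neq0 _ _ _ F.
  by rewrite card_sum card_sig.
exists w; split.
- apply: contraNneq w0 => wU0; rewrite -(mulmxKtV w (spectral_unitarymx AC) erefl).
  by rewrite wU0 mul0mx.
- move=> j Jj; have /matrixP/(_ 0 0) := Fw (inr (exist _ j Jj)).
  by rewrite /F /= colE mulmxA -colE !mxE.
- move=> i; rewrite !(scalar_delta (lin i)).
  have /matrixP/(_ 0 0) := Fw (inl i); rewrite /F.
  set G := \col_j _; rewrite !mxE => /eqP.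
  rewrite eq_complex !raddf_sum /= => /andP[/eqP Re0 /eqP Im0]; split.
    rewrite -[RHS]Re0; apply: eq_bigr => j _; rewrite !mxE.
    by case: (w 0 j) => a b /=; rewrite mulr0 subr0.
  rewrite -[RHS]Im0; apply: eq_bigr => j _; rewrite !mxE.
  by case: (w 0 j) => a b /=; rewrite mulr0 add0r.
Qed.

(** With fewer than i_+ constraints, some nonzero [w] satisfies them all and has coordinates only
    along positive eigenvalues. Its form is then positive, although it is a sum of two values that
    are at most 0. *)
Lemma i_plus_le (I : finType) (f : I -> 'rV[R]_n -> R) :
  (forall i, scalar (f i)) ->
  (forall v, (forall i, f i v = 0) -> qform A v <= 0) ->
  (i_plus A <= #|I|)%N.
Proof.
move=> lin q_le0; rewrite leqNgt; apply/negP; rewrite i_plusE => ltI.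
have [||w [wU0 wJ fw]] := @spectral_constraints_neq0 I f [pred j | ~~ (0 < real_eigenvalue j)].
- exact: lin.
- pose pos := [pred j | 0 < real_eigenvalue j].
  have cC : (#|pos| + #|[predC pos]|)%N = n.
    by rewrite cardC card_ord.
  by apply: leq_trans (eq_leq cC); rewrite ltn_add2r.
have: toC (qform A (map_mx (@complex.Re R) w) + qform A (map_mx (@complex.Im R) w)) <= 0.
  by rewrite lecR -oppr_ge0 opprD addr_ge0 // oppr_ge0 q_le0 // => i; case: (fw i).
rewrite qform_complex; apply/negP/negbT/lt_geF.
have /rV0Pn[j wUj] := wU0.
rewrite (bigD1 j) //=; apply: ltr_pwDl.
  rewrite mulr_gt0 ?exprn_gt0 ?normr_gt0 // ltcR.
  by apply: contraNT wUj => ej; rewrite wJ.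
apply: sumr_ge0 => k _.
have [ek|/wJ ->] := boolP (0 < real_eigenvalue k); last by rewrite normr0 expr0n mulr0.
by rewrite mulr_ge0 ?exprn_ge0 // ler0c ltW.
Qed.

(** Dual argument: [w] is chosen with no coordinate along positive eigenvalues, so its form is at
    most 0, whereas its real and imaginary parts are not both zero and satisfy the constraints. *)
Lemma i_plus_ge (I : finType) (f : I -> 'rV[R]_n -> R) :
  (forall i, scalar (f i)) ->
  (forall v, v != 0 -> (forall i, f i v = 0) -> 0 < qform A v) ->
  (n <= i_plus A + #|I|)%N.
Proof.
move=> lin q_gt0; rewrite leqNgt i_plusE addnC; apply/negP => ltI.
have [||w [wU0 wJ fw]] := @spectral_constraints_neq0 I f [pred j | 0 < real_eigenvalue j].
- exact: lin.
- exact: ltI.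
have fRe i : f i (map_mx (@complex.Re R) w) = 0 by case: (fw i).
have fIm i : f i (map_mx (@complex.Im R) w) = 0 by case: (fw i).
have q0 : qform A 0 = 0 by rewrite /qform !mul0mx mxE.
have q_ge0 v : (forall i, f i v = 0) -> 0 <= qform A v.
  by have [->|v0 fv] := eqVneq v 0; [rewrite q0 | rewrite ltW ?q_gt0].
have: toC (qform A (map_mx (@complex.Re R) w) + qform A (map_mx (@complex.Im R) w)) > 0.
  rewrite ltcR lt0r addr_ge0 ?q_ge0 // andbT paddr_eq0 ?q_ge0 //.
  apply: contraNN wU0 => /andP[/eqP qx /eqP qy].
  have x0 : map_mx (@complex.Re R) w = 0.
    by apply/eqP/negPn/negP => /q_gt0/(_ fRe); rewrite qx ltxx.
  have y0 : map_mx (@complex.Im R) w = 0.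
    by apply/eqP/negPn/negP => /q_gt0/(_ fIm); rewrite qy ltxx.
  have -> : w = 0; last by rewrite mul0mx.
  apply/rowP=> j; rewrite [LHS]complexE mxE.
  move/rowP: x0 => /(_ j); move/rowP: y0 => /(_ j); rewrite !mxE => -> ->.
  by rewrite rmorph0 mulr0 addr0.
rewrite qform_complex; apply/negP/negbT/le_gtF; apply: sumr_le0 => k _.
have [/wJ ->|ek] := boolP (0 < real_eigenvalue k); first by rewrite normr0 expr0n mulr0.
by rewrite mulr_le0_ge0 ?exprn_ge0 // lecR leNgt.
Qed.

End Inertia.

(** * Matrices supported on the edges met by a vertex cover *)

Section VertexCover.
Variables (R : rcfType) (n : nat) (A : 'M[R]_n) (S : {set 'I_n}).
Hypothesis symA : A^T = A.
Hypothesis indepA : forall u w, u \notin S -> w \notin S -> A u w = 0.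

(** The cofactor of [x 0 a] when the form is grouped over the cover: columns outside [S] count twice
    because the symmetric entry, whose row lies outside [S], is charged to [a] as well. *)
Definition half_form (a : 'I_n) (x : 'rV[R]_n) : R :=
  \sum_u A a u * x 0 u + \sum_(u | u \notin S) A a u * x 0 u.

Lemma half_form_scalar a : scalar (half_form a).
Proof.
move=> k x y; rewrite /half_form mulrDr !mulr_sumr addrACA -!big_split /=.
by congr (_ + _); apply: eq_bigr => u _; rewrite !mxE; ring.
Qed.

Lemma qform_cover x : qform A x = \sum_(a in S) x 0 a * half_form a x.
Proof.
have AC a u : A a u = A u a by rewrite -[in LHS]symA mxE.
transitivity (\sum_a x 0 a * \sum_u A a u * x 0 u).
  rewrite qformE; apply: eq_bigr => a _; rewrite mulrC; congr (_ * _).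
  by apply: eq_bigr => u _; rewrite mulrC AC.
rewrite (bigID (mem S)) /=; under [RHS]eq_bigr do rewrite /half_form mulrDr.
rewrite big_split /=; congr (_ + _).
under [RHS]eq_bigr do rewrite mulr_sumr.
rewrite [RHS]exchange_big /=; apply: eq_bigr => u uS.
rewrite mulr_sumr (bigID (mem S)) /= [X in _ + X]big1 ?addr0; last first.
  by move=> w wS; rewrite indepA // mul0r mulr0.
by apply: eq_bigr => w _; rewrite (AC u w); ring.
Qed.

Lemma coord_scalar u : scalar (fun x : 'rV[R]_n => x 0 u).
Proof. by move=> k x y; rewrite !mxE. Qed.

(** Setting the coordinates in [S] to zero annihilates the form. *)
Lemma i_plus_cover_le : (i_plus A <= #|S|)%N.
Proof.
rewrite -card_sig; apply: (@i_plus_le _ _ _ symA _ (fun a x => x 0 (val a))).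
  by move=> a; apply: coord_scalar.
move=> x x0; rewrite qform_cover big1 // => a aS.
by rewrite (x0 (exist _ a aS)) mul0r.
Qed.

(* On the common kernel of the constraints [x_a = half_form a x] the form is the
   sum of squares of the [x_a]. *)
Lemma i_plus_cover (T : {set 'I_n}) :
  [disjoint S & T] -> #|T| = #|S| ->
  (forall x : 'rV[R]_n, (forall u, u \notin T -> x 0 u = 0) ->
     (forall a, a \in S -> \sum_u A a u * x 0 u = 0) -> x = 0) ->
  i_plus A = #|S|.
Proof.
move=> disST cardT kerA; apply/eqP; rewrite eqn_leq i_plus_cover_le /=.
(* There are n - #|S| constraints: [x_u = half_form u x] for [u] in [S], and [x_u = 0] for [u]
   outside both [S] and [T]. *)
pose f (u : {u | u \notin T}) (x : 'rV[R]_n) :=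
  if val u \in S then x 0 (val u) - half_form (val u) x else x 0 (val u).
have lin u : scalar (f u).
  move=> k x y; rewrite /f; case: ifP => _; last by rewrite !mxE.
  by rewrite half_form_scalar !mxE; ring.
suff: (n <= i_plus A + #|{: {u | u \notin T}}|)%N.
  rewrite card_sig => le_n; rewrite -cardT.
  have : (#|T| + #|[pred u | u \notin T]|)%N = n by rewrite cardC card_ord.
  lia.
apply: i_plus_ge lin _ => // x xn0 fx0.
have xS a : a \in S -> x 0 a = half_form a x.
  move=> aS; have aT : a \notin T by rewrite (disjointFr disST).
  by have := fx0 (exist _ a aT); rewrite /f /= aS => /eqP; rewrite subr_eq0 => /eqP.
have qE : qform A x = \sum_(a in S) x 0 a ^+ 2.
  by rewrite qform_cover; apply: eq_bigr => a aS; rewrite -xS.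
have q_ge0 : forall a, a \in S -> 0 <= x 0 a ^+ 2 by move=> a _; apply: sqr_ge0.
rewrite qE lt0r sumr_ge0 // andbT; apply: contraNneq xn0 => q0.
have xS0 a : a \in S -> x 0 a = 0.
  by move=> aS; have /eqP := psumr_eq0P q_ge0 q0 aS; rewrite sqrf_eq0 => /eqP.
apply/eqP/kerA.
  move=> u uT; have [/xS0//|uS] := boolP (u \in S).
  by have := fx0 (exist _ u uT); rewrite /f /= (negPf uS).
(* With the coordinates in [S] gone, both sums in [half_form] equal the full row sum, so twice the
   row sum vanishes. *)
move=> a aS; have: half_form a x = 0 by rewrite -xS // xS0.
rewrite /half_form (bigID (mem S)) /= big1 ?add0r; last first.
  by move=> u uS; rewrite xS0 ?mulr0.
by move/eqP; rewrite -mulr2n mulrn_eq0 => /eqP.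
Qed.

End VertexCover.

(** * The unique cycle: absence of chords, and distances along it *)

(** A chord closes an arc of [c] into a cycle [c'] having the chord as an edge; [c] does not have
    that edge, against uniqueness. *)
Lemma unique_cycle_chordless n (adj : rel 'I_n) (c : seq 'I_n) :
  symmetric adj -> irreflexive adj -> is_cycle adj c ->
  (forall c', is_cycle adj c' -> cycle_edges c' = cycle_edges c) ->
  {in c &, forall x y, adj x y = (next c x == y) || (next c y == x)}.
Proof.
move=> adj_sym adj_irr cyc_c uniq_c x y xc yc.
have /and3P[Uc size_c adj_c] := cyc_c.
apply/idP/idP; last first.
  case/orP=> /eqP <-; first exact: next_cycle adj_c xc.
  by rewrite adj_sym; apply: next_cycle adj_c yc.
move=> adj_xy; have y_neq_x : y != x by apply: contraTneq adj_xy => ->; rewrite adj_irr.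
apply/negPn/negP => no_edge; have [i s rot_c] := rot_to xc.
have nextE z : next c z = next (x :: s) z by rewrite -rot_c next_rot.
have : y \in s by move: yc; rewrite -(mem_rot i) rot_c inE (negPf y_neq_x).
move=> /splitPr sE; case: sE rot_c nextE => p1 p2 rot_c nextE.
have Uxs : uniq (x :: p1 ++ y :: p2) by rewrite -rot_c rot_uniq.
pose c' := x :: rcons p1 y.
have Uc' : uniq c'.
  by move: Uxs; rewrite -cat_rcons -cat_cons cat_uniq => /andP[].
have cyc_c' : is_cycle adj c'.
  rewrite /is_cycle Uc' /= size_rcons !ltnS; apply/andP; split.
    (* An empty arc would make [y] the successor of [x], so [c'] has at least three vertices. *)
    case: p1 nextE {rot_c Uxs c' Uc'} => // nextE.
    by move: no_edge; rewrite nextE /= eqxx eqxx.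
  rewrite rcons_path last_rcons adj_sym adj_xy andbT.
  move: adj_c; rewrite -(rot_cycle i) rot_c /= rcons_cat /= -cat_rcons cat_path.
  by case/andP.
have y_p1 : y \notin p1.
  move: Uxs; rewrite cons_uniq cat_uniq => /andP[_ /and3P[_ + _]].
  by apply: contra => y_p1; apply/hasP; exists y; rewrite ?mem_head.
have yc' : y \in c' by rewrite inE mem_rcons mem_head orbT.
have next_y : next c' y = x.
  rewrite next_nth yc' /c' /= eq_sym (negPf y_neq_x) nth_default // size_rcons ltnS.
  by rewrite -cats1 index_cat (negPf y_p1) /= eqxx addn0.
have : (y, x) \in cycle_edges c'.
  rewrite inE; apply/and3P; split=> //; first exact: mem_head.
  by apply/orP; left; apply/eqP.
by rewrite uniq_c // inE /= orbC (negPf no_edge) !andbF.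
Qed.

Section CyclicDistance.
Variables (T : eqType) (M : pred T) (c : seq T).
Hypotheses (Uc : uniq c) (hasM : has M c).

(** The rotation starts at [x] itself, so elements of [M] have distance 0; the gap after a major
    vertex is the distance from its successor. *)
Definition next_dist (x : T) : nat := find M (rot (index x c) c).

Lemma rot_index_next x : x \in c ->
  rot (index (next c x) c) c = rot (index x c).+1 c.
Proof.
move=> xc; have lt_x : (index x c < size c)%N by rewrite index_mem.
rewrite next_nth xc; case: c Uc lt_x => // y s Uys; rewrite ltnS => le_x.
have [lt_xs|ge_xs] := ltnP (index x (y :: s)) (size s).
  by rewrite -[nth y s _]/(nth y (y :: s) _.+1) index_uniq.
(* Wrap-around: [x] is last, its successor is the head, and rotating by the full length is the
   identity. *)
rewrite nth_default // index_head rot0.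
have -> : index x (y :: s) = size s by apply/eqP; rewrite eqn_leq le_x.
by rewrite -[(size s).+1]/(size (y :: s)) rot_size.
Qed.

Lemma next_dist_le x : (next_dist x <= size c)%N.
Proof. by rewrite (leq_trans (find_size _ _)) // size_rot. Qed.

Lemma next_dist0 x : x \in c -> M x -> next_dist x = 0.
Proof. by move=> xc Mx; rewrite /next_dist rot_index //= Mx. Qed.

Lemma next_distS x : x \in c -> ~~ M x ->
  next_dist x = (next_dist (next c x)).+1.
Proof.
move=> xc nMx; rewrite /next_dist rot_index_next // rotS ?index_mem //.
have: has M (rot (index x c) c) by rewrite has_rot.
(* Passing to the successor moves [x] to the end of the rotation; [M] is already met in [s], so the
   appended [x] does not affect [find]. *)
rewrite rot_index //; set s := (_ ++ _); rewrite rot1_cons /= (negPf nMx) /= => hasMs.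
by rewrite -cats1 find_cat hasMs.
Qed.

Lemma map_next : perm_eq [seq next c x | x <- c] c.
Proof.
apply: uniq_perm => //; first by rewrite map_inj_uniq //; apply: can_inj (prev_next Uc).
move=> x; apply/mapP/idP => [[y yc ->]|xc]; first by rewrite mem_next.
by exists (prev c x); rewrite ?mem_prev ?next_prev.
Qed.

(* Each non-[M] element pairs an even distance with an odd one, so the excess of even
   distances is carried by the elements of [M] followed by an even distance. *)
Lemma count_even_next_dist :
  (2 * count (fun x => ~~ odd (next_dist x)) c =
   size c + count (fun x => M x && ~~ odd (next_dist (next c x))) c)%N.
Proof.
pose e x : nat := ~~ odd (next_dist x).
have countE (P : pred T) : count P c = (\sum_(x <- c) P x)%N.
  by rewrite -sum1_count big_mkcond.
rewrite !countE -sum1_size mul2n -addnn.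
(* One copy of the sum is shifted along [next], a permutation of [c], to compare each element with
   its successor. *)
have -> : (\sum_(x <- c) e x + \sum_(x <- c) e x =
    \sum_(x <- c) e x + \sum_(x <- c) e (next c x))%N.
  by congr addn; rewrite -[LHS](perm_big _ map_next) big_map.
rewrite -!big_split; apply: eq_big_seq => x xc; rewrite /e /=.
have [Mx|nMx] := boolP (M x); first by rewrite (next_dist0 xc Mx).
by rewrite (next_distS xc nMx) /=; case: odd.
Qed.

End CyclicDistance.

Lemma gapsE n (adj : rel 'I_n) (c : seq 'I_n) : uniq c ->
  gaps adj c =
  [seq next_dist (major adj c) c (next c x) | x <- c & major adj c x].
Proof.
move=> Uc; have zipE : zip (iota 0 (size c)) c = [seq (index x c, x) | x <- c].
  case: c Uc => // x0 s Us; set c := x0 :: s.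
  apply: (@eq_from_nth _ (0, x0)); first by rewrite size_zip size_iota size_map minnn.
  rewrite size_zip size_iota minnn => i lt_i.
  by rewrite nth_zip ?size_iota // nth_iota // (nth_map x0) // index_uniq.
rewrite /gaps zipE filter_map -map_comp; apply/eq_in_map => x.
rewrite mem_filter => /andP[_ xc] /=.
by rewrite /gap /next_dist rot_index_next.
Qed.

Lemma signed_adj_sym (R : pzRingType) n (adj pos : rel 'I_n) :
  symmetric adj -> symmetric pos ->
  (signed_adj R adj pos)^T = signed_adj R adj pos.
Proof. by move=> sa sp; apply/matrixP=> i j; rewrite !mxE sa sp. Qed.

Lemma signed_adj_neq0 (R : nzRingType) n (adj pos : rel 'I_n) x y :
  (signed_adj R adj pos x y != 0) = adj x y.
Proof.
rewrite mxE; case: (adj x y); last by rewrite eqxx.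
by case: (pos x y); rewrite ?oppr_eq0 oner_eq0.
Qed.

(** * Canonical unicyclic graphs with at least one leaf *)

Section NonCycle.
Variables (R : rcfType) (n : nat) (adj pos : rel 'I_n) (c : seq 'I_n).
Hypotheses (adj_sym : symmetric adj) (pos_sym : symmetric pos).
Hypothesis Uc : uniq c.
Hypothesis chordless :
  {in c &, forall x y, adj x y = (next c x == y) || (next c y == x)}.
Hypothesis canon : canonical adj c.
Hypothesis not_cycle : exists x, x \notin c.

Local Notation A := (signed_adj R adj pos).
Local Notation M := (major adj c).
Local Notation E := (next_dist M c).

Let has_major : has M c.
Proof.
have [x xc] := not_cycle; case: canon => /(_ x xc) nbr _.
have /card_gt0P[y] : (0 < #|[set y in c | adj x y]|)%N by rewrite nbr.
rewrite inE => /andP[yc adj_xy]; apply/hasP; exists y => //.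
by rewrite /major yc; apply/existsP; exists x; rewrite xc adj_sym.
Qed.

Let major_nbr x y : x \in c -> y \notin c -> adj x y -> M x.
Proof. by move=> xc yc xy; rewrite /major xc; apply/existsP; exists y; rewrite yc. Qed.

Let leaf_nbr_inj x y z :
  x \in c -> y \in c -> z \notin c -> adj x z -> adj y z -> x = y.
Proof.
move=> xc yc zc xz yz; case: canon => /(_ z zc)/eqP/cards1P[w zE] _.
have: x \in [set w] by rewrite -zE inE xc adj_sym.
have: y \in [set w] by rewrite -zE inE yc adj_sym.
by rewrite !inE => /eqP-> /eqP->.
Qed.

Definition even_dist := [set x | (x \in c) && ~~ odd (E x)].

(** The matching of the cover into its complement. A major vertex has a neighbour off [c], so the
    default [x] is never returned for it. *)
Definition mate (x : 'I_n) : 'I_n :=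
  if M x then odflt x [pick y | (y \notin c) && adj x y] else next c x.

Lemma mate_major x : M x -> mate x \notin c /\ adj x (mate x).
Proof.
rewrite /mate => Mx; rewrite Mx; case/andP: Mx => _ /existsP[y yP].
by case: pickP => [z /andP[]//|/(_ y)]; rewrite yP.
Qed.

Lemma mate_minor x : ~~ M x -> mate x = next c x.
Proof. by rewrite /mate => /negPf->. Qed.

Lemma mate_inj : {in even_dist &, injective mate}.
Proof.
move=> x y; rewrite !inE => /andP[xc _] /andP[yc _] exy.
have [Mx|nMx] := boolP (M x); have [My|nMy] := boolP (M y).
- have [bx ax] := mate_major Mx; have [by' ay] := mate_major My.
  by apply: leaf_nbr_inj xc yc bx ax _; rewrite exy.
- by have [] := mate_major Mx; rewrite exy mate_minor // mem_next yc.
- by have [] := mate_major My; rewrite -exy mate_minor // mem_next xc.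
- by move: exy; rewrite !mate_minor //; apply: (can_inj (prev_next Uc)).
Qed.

Lemma mate_notin_even x : x \in even_dist -> mate x \notin even_dist.
Proof.
rewrite !inE => /andP[xc eEx]; have [Mx|nMx] := boolP (M x).
  by have [/negPf->] := mate_major Mx.
rewrite mate_minor // mem_next xc /=.
by move: eEx; rewrite (next_distS Uc has_major xc nMx) /= negbK => ->.
Qed.

(** Major vertices have distance 0 and lie in the set, which covers the leaf edges; along a cycle
    edge leaving a non-major vertex the distance drops by one, so two odd distances are never
    adjacent. *)
Lemma even_dist_cover u w : u \notin even_dist -> w \notin even_dist -> A u w = 0.
Proof.
move=> uS wS; apply/eqP; rewrite -[_ == 0]negbK signed_adj_neq0.
wlog uc : u w uS wS / u \in c => [WL|].
  have [/WL->//|uc] := boolP (u \in c).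
  have [wc|wc] := boolP (w \in c); last by case: canon => _; apply.
  by rewrite adj_sym; apply: WL.
have notM x : x \in c -> x \notin even_dist -> ~~ M x.
  by move=> xc; rewrite inE xc; apply: contra => Mx; rewrite next_dist0.
have [wc|wc] := boolP (w \in c); last first.
  by apply: contra (notM u uc uS); apply: major_nbr.
rewrite chordless //.
have noedge x y : x \in c -> x \notin even_dist -> y \notin even_dist -> next c x != y.
  move=> xc xS yS; apply: contraNneq yS => <-; rewrite inE mem_next xc /=.
  move: (xS); rewrite inE xc negbK (next_distS Uc has_major xc) //=.
  exact: notM.
by rewrite negb_or !noedge.
Qed.

(** Triangularity of the matching: the row of [a] determines the coordinate at [mate a] once the
    other neighbours of [a] have coordinate zero. Cycle vertices are treated by decreasing distance,
    then leaves. *)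
Lemma mate_kernel (x : 'rV[R]_n) :
  (forall u, u \notin mate @: even_dist -> x 0 u = 0) ->
  (forall a, a \in even_dist -> \sum_u A a u * x 0 u = 0) -> x = 0.
Proof.
move=> xT xS.
have row_mate a : a \in even_dist ->
    (forall u, adj a u -> u != mate a -> x 0 u = 0) -> adj a (mate a) ->
    x 0 (mate a) = 0.
  move=> aS others adj_ab; move: (xS a aS).
  rewrite (bigD1 (mate a)) //= big1 ?addr0 => [/eqP|u u_neq].
    by rewrite mulf_eq0 (negPf (_ : A a _ != 0)) ?signed_adj_neq0 // => /eqP.
  have [/others->//|nadj] := boolP (adj a u); first by rewrite mulr0.
  by move: nadj; rewrite -(signed_adj_neq0 R adj pos) negbK => /eqP->; rewrite mul0r.
have xc u : u \in c -> x 0 u = 0.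
  have [m] := ubnP (size c - E u); elim: m u => // m IHm u; rewrite ltnS => le_m uc.
  have [/imsetP[a aS uE]|/xT//] := boolP (u \in mate @: even_dist).
  have ac : a \in c by move: aS; rewrite inE => /andP[].
  have nMa : ~~ M a by apply: contraL uc => /mate_major[]; rewrite uE.
  have uN : u = next c a by rewrite uE mate_minor.
  have adj_au : adj a u by rewrite chordless // uN eqxx.
  rewrite uE; apply: row_mate; rewrite -?uE // => w adj_aw w_neq_u.
  have wc : w \in c by apply: contraNT nMa => wc; apply: major_nbr adj_aw.
  have: adj a w by []; rewrite chordless // -uN eq_sym (negPf w_neq_u) /= => /eqP wN.
  (* The remaining neighbour [w] precedes [a]. If major, it lies in the cover and is no mate;
     otherwise its distance is that of [u] plus 2, and induction applies. *)
  have [Mw|nMw] := boolP (M w).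
    apply: xT; apply/imsetP => -[b bS wE].
    by have := mate_notin_even bS; rewrite -wE inE wc next_dist0.
  apply: (IHm _ _ wc).
  have Ea := next_distS Uc has_major ac nMa.
  have Ew := next_distS Uc has_major wc nMw.
  have := next_dist_le M c w; move: le_m; rewrite Ew wN Ea -uN; move: (E u) (size c) => p q; lia.
apply/rowP => u; rewrite mxE; have [/xc//|uc] := boolP (u \in c).
have [/imsetP[a aS uE]|/xT//] := boolP (u \in mate @: even_dist).
have ac : a \in c by move: aS; rewrite inE => /andP[].
have Ma : M a by apply: contraNT uc => nMa; rewrite uE mate_minor ?mem_next.
have [_ adj_ab] := mate_major Ma.
rewrite uE; apply: row_mate => // w adj_aw w_neq.
have [/xc//|wc] := boolP (w \in c).
(* Another leaf of [a] is no mate: the vertex matched to it would be its only cycle neighbour,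
   namely [a]. *)
apply: xT; apply: contra w_neq => /imsetP[b bS wE].
have bc : b \in c by move: bS; rewrite inE => /andP[].
have Mb : M b by apply: contraNT wc => nMb; rewrite wE mate_minor ?mem_next.
have [_ adj_bw] := mate_major Mb.
by rewrite wE (@leaf_nbr_inj a b w) // wE.
Qed.

Lemma i_plus_noncycle :
  (2 * i_plus A = size c + count (fun l => ~~ odd l) (gaps adj c))%N.
Proof.
have symA := signed_adj_sym R adj_sym pos_sym.
have -> : i_plus A = #|even_dist|.
  apply: (i_plus_cover symA even_dist_cover (T := mate @: even_dist)).
  - rewrite disjoint_sym disjoint_subset; apply/subsetP => _ /imsetP[x xS ->].
    exact: mate_notin_even.
  - exact: card_in_imset mate_inj.
  - exact: mate_kernel.
have -> : #|even_dist| = count (fun x => ~~ odd (E x)) c.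
  rewrite -size_filter -(card_uniqP (filter_uniq _ Uc)); apply: eq_card => x.
  by rewrite !inE mem_filter andbC.
rewrite (count_even_next_dist Uc has_major) (gapsE adj Uc) count_map.
rewrite count_filter; congr addn; apply: eq_count => x /=; exact: andbC.
Qed.

End NonCycle.

(** * Telescoping along a signed path *)

Section SignedPath.
Variables (R : comNzRingType) (s : nat -> R).
Hypothesis s2 : forall i, s i * s i = 1.

Definition pair_form (x : nat -> R) (j : nat) : R :=
  s j.*2 * x j.*2 + s j.*2.+1 * x j.+1.*2.

Definition path_sign (j : nat) : R := \prod_(i < j) - (s i.*2 * s i.*2.+1).

Lemma path_signE j : path_sign j = (-1) ^+ j * \prod_(i < j.*2) s i.
Proof.
elim: j => [|j IHj]; first by rewrite /path_sign !big_ord0 mulr1.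
by rewrite /path_sign big_ord_recr /= -/(path_sign j) IHj doubleS !big_ord_recr /= exprS; ring.
Qed.

Lemma path_sign2 j : path_sign j * path_sign j = 1.
Proof.
rewrite /path_sign -big_split big1 //= => i _.
by rewrite mulrNN mulrACA !s2 mulr1.
Qed.

Lemma sum_pair_form (x : nat -> R) (h : nat) :
  \sum_(i < h.*2) s i * x i * x i.+1 = \sum_(j < h) x j.*2.+1 * pair_form x j.
Proof.
elim: h => [|h IHh]; first by rewrite !big_ord0.
by rewrite doubleS !big_ord_recr IHh /= /pair_form doubleS; ring.
Qed.

(** As the signs square to 1, [pair_form x j] can be solved for [x_(2j+2)]; multiplying by
    [path_sign j.+1] turns the recurrence into a telescoping sum. *)
Lemma path_sign_end (x : nat -> R) (h : nat) :
  path_sign h * x h.*2 =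
  x 0 + \sum_(j < h) path_sign j.+1 * s j.*2.+1 * pair_form x j.
Proof.
elim: h => [|h IHh]; first by rewrite /path_sign !big_ord0 mul1r addr0.
rewrite big_ord_recr addrA -IHh /= /pair_form.
have -> : path_sign h.+1 = - (path_sign h * (s h.*2 * s h.*2.+1)).
  by rewrite /path_sign big_ord_recr /= mulrN.
have := s2 h.*2; have := s2 h.*2.+1.
move: (s h.*2) (s _) (x h.*2) (x _) (path_sign h) => a b u w p bb aa.
have -> : - (p * (a * b)) * b * (a * u + b * w) =
  - p * (a * a) * (b * b) * u - p * a * b * (b * b) * w by ring.
by rewrite aa bb; ring.
Qed.

Lemma pair_form_eq0 (x : nat -> R) (h : nat) :
  x 0 = 0 -> (forall j, (j < h)%N -> pair_form x j = 0) ->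
  forall j, (j <= h)%N -> x j.*2 = 0.
Proof.
move=> x0 y0 j le_jh; rewrite -[LHS]mul1r -(path_sign2 j) -mulrA path_sign_end.
rewrite x0 add0r big1 ?mulr0 // => i _; rewrite y0 ?mulr0 //.
exact: leq_trans (ltn_ord i) le_jh.
Qed.

End SignedPath.

(** * Inertia of the quadratic form of a signed cycle *)

Section Cycle.
Variables (R : rcfType) (n : nat) (A : 'M[R]_n) (g : nat) (p : nat -> 'I_n) (s : nat -> R).
Hypothesis symA : A^T = A.
Hypothesis s2 : forall i, s i * s i = 1.
Hypothesis p_cycle : p g = p 0.
Hypothesis p_onto : forall x, exists2 i, (i < g)%N & x = p i.
Hypothesis g_n : g = n.
Let X (v : 'rV[R]_n) (i : nat) : R := v 0 (p i).
Hypothesis qformA : forall v, qform A v = \sum_(i < g) s i * X v i * X v i.+1 *+ 2.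

Let X_eq0 v : (forall i, (i < g)%N -> X v i = 0) -> v = 0.
Proof.
by move=> Xv; apply/rowP => x; have [i ig ->] := p_onto x; rewrite mxE; apply: Xv.
Qed.

Let parity i : i = (odd i + i./2.*2)%N. Proof. by rewrite odd_double_half. Qed.

Let half_eq0 v h : (g <= h.*2.+1)%N -> X v 0 = 0 ->
  (forall j, (j < h)%N -> pair_form s (X v) j = 0) ->
  (forall j, (j < h)%N -> X v j.*2.+1 = 0) -> v = 0.
Proof.
move=> gh x0 y0 xo; apply: X_eq0 => i ig; rewrite (parity i).
case: (odd i) (parity i) => iE; last by apply: (pair_form_eq0 s2 x0 y0); lia.
by apply: xo; lia.
Qed.

Lemma i_plus_odd_cycle h : g = h.*2.+1 ->
  i_plus A = h.+1 <-> (-1) ^+ h * \prod_(i < g) s i = 1.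
Proof.
move=> gE; set e := _ * _.
have eE : e = s h.*2 * path_sign s h.
  by rewrite /e gE path_signE big_ord_recr /=; ring.
have e2 : e * e = 1 by rewrite eE mulrACA s2 path_sign2 // mulr1.
have Xg v : X v h.*2.+1 = X v 0 by rewrite /X -gE p_cycle.
pose k j := e * path_sign s j.+1 * s j.*2.+1.
(* The closing term [s_(2h) x_(2h) x_0] is expanded by [path_sign_end]; its mixed terms in [x_0] and
   [pair_form] are absorbed into the first factors through [k j], leaving [e x_0^2]. *)
have qE v : qform A v = ((\sum_(j < h) (X v j.*2.+1 + k j * X v 0) * pair_form s (X v) j)
    + e * X v 0 ^+ 2) *+ 2.
  rewrite qformA gE sumrMnl big_ord_recr /= Xg sum_pair_form; congr (_ *+ 2).
  have -> : s h.*2 * X v h.*2 = e * (path_sign s h * X v h.*2).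
    by rewrite eE -mulrA (mulrA (path_sign s h)) path_sign2 // mul1r.
  rewrite path_sign_end // mulrDr mulrDl -mulrA -expr2 addrCA [RHS]addrC; congr (_ + _).
  rewrite mulr_sumr mulr_suml -big_split; apply: eq_bigr => j _ /=.
  by rewrite /k; ring.
(* On this kernel the form is [2e] times a sum of squares, so the same [h] constraints give the
   lower bound when e = 1 and the upper bound when e = -1. *)
pose f (j : 'I_h) (v : 'rV[R]_n) :=
  X v j.*2.+1 + k j * X v 0 - e * pair_form s (X v) j.
have lin j : scalar (f j).
  by move=> a u v; rewrite /f /X /pair_form !mxE; ring.
have q_ker v : (forall j, f j v = 0) ->
    qform A v = e * (\sum_(j < h) pair_form s (X v) j ^+ 2 + X v 0 ^+ 2) *+ 2.
  move=> fv; rewrite qE mulrDr mulr_sumr; congr ((_ + _) *+ 2).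
  apply: eq_bigr => j _; have /eqP := fv j; rewrite subr_eq0 => /eqP ->.
  by rewrite expr2; ring.
have [e1|e_neq1] := eqVneq e 1.
  split=> // _; apply/eqP; rewrite eqn_leq; apply/andP; split.
    rewrite -[h.+1]card_ord.
    apply: (@i_plus_le _ _ _ symA _
      (* The extra index [ord_max] carries the constraint [x_0 = 0]; the others kill the odd
         coordinates. *)
      (fun (j : 'I_h.+1) (v : 'rV[R]_n) => if j == ord_max then X v 0 else X v j.*2.+1)).
      by move=> j a u v; case: ifP; rewrite /X !mxE.
    move=> v xv; rewrite qformA gE sumrMnl big_ord_recr /= Xg sum_pair_form.
    have -> : X v 0 = 0 by have := xv ord_max; rewrite eqxx.
    rewrite mulr0 addr0 big1 ?mul0rn // => j _.
    have := xv (widen_ord (leqnSn h) j); rewrite ifN => [/= ->|]; first by rewrite mul0r.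
    by rewrite -val_eqE /= neq_ltn ltn_ord.
  suff: (n <= i_plus A + #|'I_h|)%N by rewrite card_ord; lia.
  apply: (@i_plus_ge _ _ _ symA _ f) => // v vn0 fv.
  rewrite q_ker // e1 mul1r pmulrn_lgt0 // lt0r addr_ge0 ?sqr_ge0 ?sumr_ge0 ?andbT //;
    last by move=> j _; apply: sqr_ge0.
  apply: contraNneq vn0 => /eqP; rewrite paddr_eq0 ?sqr_ge0 ?sumr_ge0 //;
    last by move=> j _; apply: sqr_ge0.
  case/andP => /eqP sum0; rewrite sqrf_eq0 => /eqP x0.
  have y0 (j : 'I_h) : pair_form s (X v) j = 0.
    apply/eqP; rewrite -sqrf_eq0; apply/eqP.
    by apply: (psumr_eq0P _ sum0) => // i _; apply: sqr_ge0.
  apply/eqP; apply: (@half_eq0 v h); rewrite ?gE // => j jh.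
    exact: (y0 (Ordinal jh)).
  have := fv (Ordinal jh); rewrite /f /= x0 (y0 (Ordinal jh)) !mulr0 addr0 subr0.
  exact.
have eN1 : e = -1.
  have : (e - 1) * (e + 1) = 0 by rewrite -subr_sqr expr1n expr2 e2 subrr.
  by move/eqP; rewrite mulf_eq0 subr_eq0 (negPf e_neq1) addr_eq0 => /eqP.
split=> [iA|e1]; last by rewrite e1 eqxx in e_neq1.
suff: (i_plus A <= #|'I_h|)%N by rewrite card_ord iA ltnn.
apply: (@i_plus_le _ _ _ symA _ f) => // v fv.
rewrite q_ker // eN1 mulN1r mulNrn oppr_le0 mulrn_wge0 // addr_ge0 ?sqr_ge0 //.
by apply: sumr_ge0 => j _; apply: sqr_ge0.
Qed.

Lemma i_plus_even_cycle h : g = h.*2 -> (0 < h)%N ->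
  i_plus A = h <-> (-1) ^+ h * \prod_(i < g) s i = -1.
Proof.
move=> gE h_gt0; rewrite gE -path_signE.
have e2 := path_sign2 s2 h; set e := path_sign s h in e2 *.
have Xg v : X v h.*2 = X v 0 by rewrite /X -gE p_cycle.
have qE v : qform A v = (\sum_(j < h) X v j.*2.+1 * pair_form s (X v) j) *+ 2.
  by rewrite qformA gE sumrMnl sum_pair_form.
have endE v : (e - 1) * X v 0 =
    \sum_(j < h) path_sign s j.+1 * s j.*2.+1 * pair_form s (X v) j.
  by rewrite mulrBl mul1r -{1}(Xg v) path_sign_end // addrAC subrr add0r.
have [e1|e_neq1] := eqVneq e 1.
  split=> [iA|eN1]; last first.
    by have /eqP := eN1; rewrite e1 -addr_eq0 (_ : 1 + 1 = 2%:R) // pnatr_eq0.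
  (* When e = 1, [endE] is a linear relation with coefficients [k j] among the pair forms. Making
     the odd coordinates proportional to [k j] costs only h - 1 constraints, index 0 being the
     reference, and kills the form. *)
  pose k j := path_sign s j.+1 * s j.*2.+1.
  have k2 j : k j * k j = 1 by rewrite mulrACA path_sign2 // s2 mulr1.
  pose f (j : 'I_h.-1) (v : 'rV[R]_n) := X v j.+1.*2.+1 - k j.+1 * k 0 * X v 1.
  suff: (i_plus A <= #|'I_h.-1|)%N by rewrite card_ord iA; lia.
  apply: (@i_plus_le _ _ _ symA _ f) => [j a u v|v fv].
    by rewrite /f /X !mxE; ring.
  rewrite qE; have -> : \sum_(j < h) X v j.*2.+1 * pair_form s (X v) j =
      k 0 * X v 1 * \sum_(j < h) k j * pair_form s (X v) j.
    rewrite mulr_sumr; apply: eq_bigr => -[[|j] jh] _ /=.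
      by rewrite mulrA [k 0 * _ * k 0]mulrAC k2 mul1r.
    have jh' : (j < h.-1)%N by lia.
    have /eqP := fv (Ordinal jh'); rewrite subr_eq0 /= => /eqP ->; ring.
  by rewrite -endE e1 subrr mul0r mulr0 mul0rn.
have eN1 : e = -1.
  have : (e - 1) * (e + 1) = 0 by rewrite -subr_sqr expr1n expr2 e2 subrr.
  by move/eqP; rewrite mulf_eq0 subr_eq0 (negPf e_neq1) addr_eq0 => /eqP.
split=> // _; apply/eqP; rewrite eqn_leq; apply/andP; split.
  rewrite -[h in (_ <= h)%N]card_ord.
  apply: (@i_plus_le _ _ _ symA _ (fun (j : 'I_h) (v : 'rV[R]_n) => X v j.*2.+1)).
    by move=> j a u v; rewrite /X !mxE.
  by move=> v xv; rewrite qE big1 ?mul0rn // => j _; rewrite xv mul0r.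
suff: (n <= i_plus A + #|'I_h|)%N by rewrite card_ord; lia.
pose f (j : 'I_h) (v : 'rV[R]_n) := X v j.*2.+1 - pair_form s (X v) j.
apply: (@i_plus_ge _ _ _ symA _ f) => [j a u v|v vn0 fv].
  by rewrite /f /X /pair_form !mxE; ring.
have xo (j : 'I_h) : X v j.*2.+1 = pair_form s (X v) j.
  by apply/eqP; rewrite -subr_eq0; apply/eqP/fv.
have qE2 : qform A v = (\sum_(j < h) pair_form s (X v) j ^+ 2) *+ 2.
  by rewrite qE; congr (_ *+ 2); apply: eq_bigr => j _; rewrite xo.
rewrite qE2 pmulrn_lgt0 // lt0r sumr_ge0 ?andbT; last by move=> j _; apply: sqr_ge0.
apply: contraNneq vn0 => sum0.
have y0 (j : 'I_h) : pair_form s (X v) j = 0.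
  apply/eqP; rewrite -sqrf_eq0; apply/eqP.
  by apply: (psumr_eq0P _ sum0) => // i _; apply: sqr_ge0.
(* Here e - 1 is nonzero, so [endE] determines [x_0] from the pair forms. *)
have x0 : X v 0 = 0.
  have := endE v; rewrite big1 => [/eqP|j _]; last by rewrite y0 mulr0.
  by rewrite mulf_eq0 subr_eq0 (negPf e_neq1) => /eqP.
apply/eqP; apply: (@half_eq0 v h); rewrite ?gE // => j jh.
  exact: (y0 (Ordinal jh)).
by rewrite (xo (Ordinal jh)) y0.
Qed.

End Cycle.

(** * Signed cycle graphs in the indexed form *)

Lemma traject_next (T : eqType) (x0 : T) (t : seq T) : uniq (x0 :: t) ->
  x0 :: t = traject (next (x0 :: t)) x0 (size t).+1
  /\ iter (size t).+1 (next (x0 :: t)) x0 = x0.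
Proof.
move=> Ut; have := cycle_next Ut; set f := next _ => /fpathP[m tE].
rewrite trajectS iterSr; case: m tE => [|m] tE; first by have := congr1 size tE; rewrite size_rcons.
have sz : size t = m by have := congr1 size tE; rewrite size_rcons size_traject => -[].
by move: tE; rewrite trajectSr sz => /rcons_inj[<- <-].
Qed.

Section SignedCycle.
Variables (R : rcfType) (n : nat) (adj pos : rel 'I_n) (c : seq 'I_n).
Hypotheses (adj_sym : symmetric adj) (pos_sym : symmetric pos).
Hypothesis cyc_c : is_cycle adj c.
Hypothesis chordless :
  {in c &, forall x y, adj x y = (next c x == y) || (next c y == x)}.
Hypothesis all_c : forall x, x \in c.

Local Notation A := (signed_adj R adj pos).

Let sgn (x : 'I_n) : R := if pos x (next c x) then 1 else -1.

Let Uc : uniq c. Proof. by case/and3P: cyc_c. Qed.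

(** Length at least three ensures that no edge is traversed in both directions, so at most one term
    of [signed_cycleE] survives. *)
Lemma next_next_neq x : next c (next c x) != x.
Proof.
have [i t rot_c] := rot_to (all_c x).
have := cyc_c; rewrite -!(next_rot i Uc) rot_c /is_cycle -(rot_uniq i) -(size_rot i) rot_c.
case/and3P=> /andP[x_t _]; case: t x_t {rot_c} => [|y [|z t]] // x_t _ _.
move: x_t; rewrite !inE !negb_or => /and3P[xy xz _].
by rewrite /= eqxx [y == x]eq_sym (negPf xy) eqxx eq_sym.
Qed.

Lemma signed_cycleE x y :
  A x y = (next c x == y)%:R * sgn x + (next c y == x)%:R * sgn y.
Proof.
rewrite mxE chordless //; case: eqP => [<-|_] /=.
  by rewrite (negPf (next_next_neq x)) mul1r mul0r addr0.
by case: eqP => [<-|_]; rewrite mul0r add0r ?mul0r // mul1r pos_sym.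
Qed.

Lemma qform_signed_cycle v :
  qform A v = \sum_(x <- c) sgn x * v 0 x * v 0 (next c x) *+ 2.
Proof.
have bigc (F : 'I_n -> R) : \sum_(x <- c) F x = \sum_x F x.
  by rewrite (big_uniq _ Uc); apply: eq_bigl => x; rewrite /= all_c.
rewrite bigc qformE; under eq_bigr do rewrite mulr_suml.
under eq_bigr => y _ do under eq_bigr => x _ do rewrite signed_cycleE mulrDr mulrDl.
under eq_bigr do rewrite big_split /=.
rewrite big_split /= exchange_big /= -big_split; apply: eq_bigr => x _ /=.
rewrite (bigD1 (next c x)) //= [X in _ + X + _]big1 => [|y]; last first.
  by rewrite eq_sym => /negPf ->; rewrite mul0r mulr0 mul0r.
rewrite [X in _ + X](bigD1 (next c x)) //= [X in _ + (_ + X)]big1 => [|y]; last first.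
  by rewrite eq_sym => /negPf ->; rewrite mul0r mulr0 mul0r.
by rewrite !eqxx mulr1n; ring.
Qed.

Lemma prod_sgn : \prod_(x <- c) sgn x = (-1) ^+ (~~ balanced pos c).
Proof.
rewrite /balanced; set z : int := \prod_(x <- c) _.
have -> : \prod_(x <- c) sgn x = z%:~R.
  by rewrite rmorph_prod; apply: eq_bigr => x _; rewrite /sgn; case: ifP.
have : z * z == 1.
  by rewrite -big_split big1 //= => x _; case: ifP.
rewrite -expr2 sqrf_eq1; have [->|_] := eqVneq z 1; first by [].
by move/eqP => ->.
Qed.

(** Merges the two parities: the signed product must be 1 for odd length and -1 for even length. *)
Lemma i_plus_cycle :
  i_plus A = uphalf (size c) <->
  (-1) ^+ (size c)./2 * (-1) ^+ (~~ balanced pos c)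
    = (-1) ^+ (~~ odd (size c)) :> R.
Proof.
have gn : size c = n.
  by rewrite -(card_uniqP Uc) -[RHS]card_ord; apply: eq_card => x; rewrite all_c.
have symA := signed_adj_sym R adj_sym pos_sym.
have := cyc_c; rewrite /is_cycle; case cE: c => [|x0 t] // /and3P[_ sz _].
have Ut : uniq (x0 :: t) by rewrite -cE.
rewrite -cE in sz *; pose p i := iter i (next c) x0; pose s i := sgn (p i).
have [trE iterE] := traject_next Ut; rewrite -cE in trE iterE.
have szE : (size t).+1 = size c by rewrite cE.
rewrite szE -/(p _) in trE iterE.
have nth_p i : (i < size c)%N -> nth x0 c i = p i.
  by move=> lt_i; rewrite {1}trE nth_traject.
have bigc (Q : Type) (i0 : Q) (op : Q -> Q -> Q) (F : 'I_n -> Q) :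
    \big[op/i0]_(x <- c) F x = \big[op/i0]_(i < size c) F (p i).
  rewrite (big_nth x0) big_mkord; apply: eq_bigr => i _.
  by rewrite nth_p.
have s2 i : s i * s i = 1 by rewrite /s /sgn; case: ifP; rewrite ?mulrNN mulr1.
have p_onto x : exists2 i, (i < size c)%N & x = p i.
  exists (index x c); first by rewrite index_mem.
  by rewrite -nth_p ?index_mem // nth_index.
have qA v : qform A v = \sum_(i < size c) s i * v 0 (p i) * v 0 (p i.+1) *+ 2.
  by rewrite qform_signed_cycle bigc.
rewrite -prod_sgn bigc -/s.
have [g_odd|g_even] := boolP (odd (size c)).
  have gE : size c = (size c)./2.*2.+1 by rewrite -[LHS]odd_double_half g_odd.
  rewrite uphalf_half g_odd expr0.
  exact: (i_plus_odd_cycle symA s2 iterE p_onto gn qA gE).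
have gE : size c = (size c)./2.*2 by rewrite -[LHS]odd_double_half (negPf g_even).
have h_gt0 : (0 < (size c)./2)%N by rewrite half_gt0 ltnW.
rewrite uphalf_half (negPf g_even) expr1.
exact: (i_plus_even_cycle symA s2 iterE p_onto gn qA gE).
Qed.

End SignedCycle.

Theorem theorem4p2 (R : rcfType) (n : nat) (adj pos : rel 'I_n)
  (adj_sym : symmetric adj) (adj_irr : irreflexive adj)
  (pos_sym : symmetric pos) (c : seq 'I_n) :
  unicyclic adj -> is_cycle adj c -> canonical adj c ->
  let g := size c in
  let ip := i_plus (signed_adj R adj pos) in
  ((forall x, x \in c) ->
     (ip = uphalf g <->
      (balanced pos c /\ (g %% 4 = 1 \/ g %% 4 = 2))%N \/
      (~~ balanced pos c /\ (g %% 4 = 0 \/ g %% 4 = 3))%N)) /\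
  ((exists x, x \notin c) -> odd g ->
     (ip = uphalf g <-> count (fun l => ~~ odd l) (gaps adj c) = 1%N)) /\
  ((exists x, x \notin c) -> ~~ odd g ->
     (ip = uphalf g <-> all odd (gaps adj c))).
Proof.
move=> [_ [_ uniq_c]] cyc_c canon g ip.
have chordless := unique_cycle_chordless adj_sym adj_irr cyc_c
  (fun c' cyc_c' => uniq_c c' c cyc_c' cyc_c).
have Uc : uniq c by case/and3P: cyc_c.
split; [move=> all_c | split=> not_cycle g_par].
- rewrite (i_plus_cycle R adj_sym pos_sym cyc_c chordless all_c) -/g.
  have signE (b1 b2 : bool) : (-1) ^+ b1 = (-1) ^+ b2 :> R <-> b1 = b2.
    split=> [/eqP|-> //]; case: b1 b2 => [] [] //; rewrite ?expr0 ?expr1.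
      by rewrite eq_sym -addr_eq0 (_ : 1 + 1 = 2%:R) // pnatr_eq0.
    by rewrite -addr_eq0 (_ : 1 + 1 = 2%:R) // pnatr_eq0.
  (* Equality of signs becomes a boolean identity between the parity of [g./2], balance and the
     parity of [g], which is a condition on [g] modulo 4. *)
  rewrite -signr_odd -signr_addb signE; case: balanced; lia.
- have := i_plus_noncycle R adj_sym pos_sym Uc chordless canon not_cycle.
  (* For odd [g], twice [uphalf g] is g + 1, which leaves exactly one even gap; for even [g] it is
     g, which leaves none. *)
  rewrite -/ip -/g; lia.
have := i_plus_noncycle R adj_sym pos_sym Uc chordless canon not_cycle.
have -> : all odd (gaps adj c) = (count (fun l => ~~ odd l) (gaps adj c) == 0).
  by rewrite -[all _ _]negbK -has_predC has_count -eqn0Ngt.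
rewrite -/ip -/g; lia.
Qed.
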